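(* Let $n\geq 1$ be an integer and let $\mathbf{T}\in\mathcal{M}_n$. The law $\mathcal{U}(\mathcal{M}_n)$ is invariant under the left translation $\mathbf{M}\mapsto\mathbf{T}\mathbf{M}$ (that is, $\mathbf{T}\mathbf{M}\sim\mathcal{U}(\mathcal{M}_n)$ whenever $\mathbf{M}\sim\mathcal{U}(\mathcal{M}_n)$) if and only if $\mathbf{T}$ is a permutation matrix. Likewise, $\mathcal{U}(\mathcal{M}_n)$ is invariant under the right translation $\mathbf{M}\mapsto\mathbf{M}\mathbf{T}$ if and only if $\mathbf{T}$ is a permutation matrix.
   Context: A real $n\times n$ matrix is Markov if its entries are non-negative and each row sums to $1$. $\mathcal{M}_n$ denotes the set of all $n\times n$ Markov matrices; it is a compact convex polytope in $\mathbb{R}^{n^2}$ of dimension $n(n-1)$, and a semigroup for the matrix product. The uniform distribution $\mathcal{U}(\mathcal{M}_n)$ on $\mathcal{M}_n$ is the normalized trace on $\mathcal{M}_n$ of the Lebesgue measure of $\mathbb{R}^{n^2}$, i.e. the probability measure obtained by normalizing the restriction to $\mathcal{M}_n$ of the $n(n-1)$-dimensional Hausdorff measure (equivalently, the Lebesgue measure of the affine hull of $\mathcal{M}_n$). *)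

(* Defs.v *)
From mathcomp Require Import all_boot all_order all_algebra.
From mathcomp Require Import all_classical all_reals all_analysis.
Import Order.TTheory GRing.Theory Num.Theory.
Import numFieldNormedType.Exports.
Set Implicit Arguments.
Unset Strict Implicit.
Unset Printing Implicit Defensive.
Local Open Scope classical_set_scope.
Local Open Scope ring_scope.

Section Hausdorff.
Context {R : realType} {m n : nat}.
Implicit Types (A B : 'M[R]_(m, n)) (S : set 'M[R]_(m, n)).

(* The library norm on matrices is the sup norm; the Euclidean distance of
   R^(m * n) has to be defined. *)
Definition mx_dist A B : R :=
  Num.sqrt (\sum_(i < m) \sum_(j < n) (A i j - B i j) ^+ 2).

(* The diameter of the empty set is -oo. *)
Definition mx_diam S : \bar R :=
  ereal_sup [set (mx_dist AB.1 AB.2)%:E | AB in S `*` S].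

(* diam(S)^s, with value 0 at the empty set even when s = 0; a singleton has
   value 1 when s = 0, so that [hausdorff 0] is the counting measure. *)
Definition diam_pow (s : nat) S : \bar R :=
  if S == set0 then 0%E else (mx_diam S ^+ s)%E.

Definition hausdorff_delta (s : nat) (delta : R) S : \bar R :=
  ereal_inf [set (\sum_(0 <= k <oo) diam_pow s (F k))%E |
    F in [set F : nat -> set 'M[R]_(m, n) |
      (forall k, (mx_diam (F k) <= delta%:E)%E) /\ S `<=` \bigcup_k F k]].

(* The s-dimensional Hausdorff (outer) measure for the Euclidean distance,
   without the constant making it agree with Lebesgue measure, which cancels
   in [markov_uniform]. *)
Definition hausdorff (s : nat) S : \bar R :=
  ereal_sup [set hausdorff_delta s delta S | delta in [set d : R | 0 < d]].

End Hausdorff.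

Section Markov.
Context {R : realType} {n : nat}.

Definition markov_mx : set 'M[R]_n :=
  [set M | (forall i j, 0 <= M i j) /\ (forall i, \sum_(j < n) M i j = 1)].

Definition borel_mx : set (set 'M[R]_n) := <<s [set U | open U] >>.

(* A law on 'M_n carried by [markov_mx]; only its values on [borel_mx] matter. *)
Definition markov_uniform (S : set 'M[R]_n) : \bar R :=
  (hausdorff (n * n.-1) (S `&` markov_mx)
   * ((fine (hausdorff (n * n.-1) markov_mx))^-1)%:E)%E.

(* The image (push-forward) of the law [mu] by [f] is [mu]. *)
Definition invariant_law (mu : set 'M[R]_n -> \bar R)
    (f : 'M[R]_n -> 'M[R]_n) : Prop :=
  forall S, borel_mx S -> mu (f @^-1` S) = mu S.

End Markov.

Arguments markov_mx R n : clear implicits.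
Arguments markov_uniform R n S : clear implicits.

(* Main.v *)
(* Multiplication by a permutation matrix is a Euclidean isometry preserving the
   set of Markov matrices, so it preserves their Hausdorff measure.

   Conversely, if T is Markov but not a permutation matrix, then the identity
   can be separated from { T M | M Markov } by a linear functional: either T is
   invertible, its inverse has a negative entry (two mutually inverse nonnegative
   matrices with unit row sums are permutation matrices) and the corresponding
   entry of T^-1 B is negative at B = 1 but nonnegative at B = T M; or T is
   singular and a kernel vector does the job. The open half-space so obtained
   contains the Markov matrix 1, hence has positive mass, while its preimage by
   M |-> T M contains no Markov matrix.

   That a relatively open part of the n(n-1)-dimensional polytope of Markov
   matrices has positive finite Hausdorff measure is shown in coordinates, all
   columns but the first being free: a grid of cubes gives the upper bound; for
   the lower bound, a countable cover of an s-dimensional box of side r by sets of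
   diameter d_k is a cover by cubes of side 2 d_k, whence
   r^s <= \sum_k (2 d_k)^s by integrating out one coordinate at a time. *)
Require Import Defs.
From mathcomp Require Import all_boot all_order all_algebra.
From mathcomp Require Import all_classical all_reals all_analysis.
From mathcomp Require Import measurable_realfun.
From mathcomp Require Import ring lra.
From mathcomp.fingroup Require Import fingroup perm.
Set Implicit Arguments.
Unset Strict Implicit.
Unset Printing Implicit Defensive.
Import Order.TTheory GRing.Theory Num.Theory.
Import numFieldNormedType.Exports.
Local Open Scope classical_set_scope.
Local Open Scope ring_scope.

(** * Nonnegative inverses and linear separation *)

Section NonnegativeInverse.
Context {R : realType} {n : nat}.
Implicit Types (T S M : 'M[R]_n).

(** If [T i k] is positive, [S *m T = 1] forces column [i] of [S] to vanish off row [k]. Two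
    positive entries in row [i] of [T] would kill that column, against [T *m S = 1]. So each row of
    [T] is a unit vector, and two equal rows of [T] would give two equal rows of the identity. *)
Lemma perm_mx_of_inverse_ge0 T S : markov_mx R n T ->
  (forall i j, 0 <= S i j) -> T *m S = 1%:M -> S *m T = 1%:M -> is_perm_mx T.
Proof.
move=> [T0 T1] S0 TS ST.
have ST0 a i k : 0 < T i k -> a != k -> S a i = 0.
  move=> Tik ak; have := congr1 (fun B : 'M[R]_n => B a k) ST.
  rewrite !mxE (negbTE ak) mulr0n => /eqP.
  rewrite psumr_eq0 => [|b _]; last by rewrite mulr_ge0.
  move=> /allP /(_ i (mem_index_enum i)) /=.
  by rewrite mulf_eq0 (gt_eqF Tik) orbF => /eqP.
have row_inj i k l : 0 < T i k -> 0 < T i l -> k = l.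
  move=> Tik Til; apply/eqP/negPn/negP => kl.
  have S_0 a : S a i = 0.
    have [->|ak] := eqVneq a k; last exact: ST0 Tik ak.
    exact: ST0 Til kl.
  have := congr1 (fun B : 'M[R]_n => B i i) TS.
  rewrite !mxE eqxx big1 => [/eqP|j _]; last by rewrite S_0 mulr0.
  by rewrite eq_sym oner_eq0.
have /choice[g Tg] : forall i, exists k, 0 < T i k.
  move=> i; apply/not_existsP => nex.
  have := T1 i; rewrite big1 => [/eqP|j _]; first by rewrite eq_sym oner_eq0.
  by apply/eqP; rewrite eq_le T0 andbT leNgt; apply/negP/nex.
have TE i k : T i k = (g i == k)%:R.
  have T_0 j : j != g i -> T i j = 0.
    move=> jg; apply/eqP; rewrite eq_le T0 andbT leNgt; apply/negP => Tij.
    by rewrite (row_inj _ _ _ Tij (Tg i)) eqxx in jg.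
  have [<-|gk] := eqVneq; last by rewrite T_0 // eq_sym.
  by rewrite -(T1 i) (bigD1 (g i)) //= [X in _ + X]big1 ?addr0 // => j; exact: T_0.
have g_inj : injective g.
  move=> i j gij; apply/eqP/negPn/negP => ij.
  have : (T *m S) i j = (T *m S) j j.
    by rewrite !mxE; apply: eq_bigr => k _; rewrite !TE gij.
  by rewrite TS !mxE eqxx (negbTE ij) => /eqP; rewrite eq_sym oner_eq0.
by apply/is_perm_mxP; exists (perm g_inj); apply/matrixP => i k;
  rewrite TE !mxE permE.
Qed.

Lemma invmx_entry_lt0 T : markov_mx R n T -> ~~ is_perm_mx T -> T \in unitmx ->
  exists i j, invmx T i j < 0.
Proof.
move=> MT nT uT; apply/not_existsP => nex; move/negP: nT; apply.
apply: (@perm_mx_of_inverse_ge0 T (invmx T)) => //; last 2 first.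
- exact: mulmxV.
- exact: mulVmx.
by move=> i j; rewrite leNgt; apply/negP => Tij; apply: (nex i); exists j.
Qed.

(* [A] is the inverse of [T] or, when [T] is singular, a multiple of a matrix
   of left (right in [right_separation]) kernel vectors of [T]. *)
Lemma left_separation T : markov_mx R n T -> ~~ is_perm_mx T ->
  exists (A : 'M[R]_n) i j, A i j < 0 /\ (forall k, 0 <= (A *m T) i k).
Proof.
move=> MT nT; have [uT|] := boolP (T \in unitmx).
  have [i [j Tij]] := invmx_entry_lt0 MT nT uT.
  by exists (invmx T), i, j; split=> // k; rewrite mulVmx // mxE ler0n.
rewrite -row_free_unit -kermx_eq0 => /matrix0Pn[i [j Kij]].
(* This factor turns the entry at [i], [j] into minus a nonzero square. *)
exists (- kermx T i j *: kermx T), i, j; split=> [|k].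
  by rewrite mxE mulNr oppr_lt0 -expr2 exprn_even_gt0.
by rewrite -scalemxAl mulmx_ker scaler0 mxE.
Qed.

Lemma right_separation T : markov_mx R n T -> ~~ is_perm_mx T ->
  exists (A : 'M[R]_n) i j, A i j < 0 /\ (forall k, 0 <= (T *m A) k j).
Proof.
move=> MT nT; have [uT|] := boolP (T \in unitmx).
  have [i [j Tij]] := invmx_entry_lt0 MT nT uT.
  by exists (invmx T), i, j; split=> // k; rewrite mulmxV // mxE ler0n.
rewrite -row_full_unit -cokermx_eq0 => /matrix0Pn[i [j Kij]].
exists (- cokermx T i j *: cokermx T), i, j; split=> [|k].
  by rewrite mxE mulNr oppr_lt0 -expr2 exprn_even_gt0.
by rewrite -scalemxAr mulmx_coker scaler0 mxE.
Qed.

End NonnegativeInverse.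

(** * Hausdorff measure under isometries *)

Section HausdorffIsometry.
Context {R : realType} {m n : nat}.
Implicit Types (A B : 'M[R]_(m, n)) (S : set 'M[R]_(m, n)).

Lemma mx_dist_ge0 A B : 0 <= mx_dist A B.
Proof. exact: sqrtr_ge0. Qed.

Lemma mx_diam_ge0 S : S !=set0 -> (0 <= mx_diam S)%E.
Proof.
move=> [A SA]; apply: (@le_trans _ _ (mx_dist A A)%:E).
  by rewrite lee_fin mx_dist_ge0.
by apply: ereal_sup_ubound; exists (A, A).
Qed.

Lemma diam_pow_ge0 s S : (0 <= diam_pow s S)%E.
Proof.
rewrite /diam_pow; case: ifPn => // /set0P S0.
by rewrite expe_ge0 // mx_diam_ge0.
Qed.

Context (f : 'M[R]_(m, n) -> 'M[R]_(m, n)).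
Hypothesis f_isom : forall A B, mx_dist (f A) (f B) = mx_dist A B.

Lemma mx_diam_preimage S : (mx_diam (f @^-1` S) <= mx_diam S)%E.
Proof.
apply: ge_ereal_sup => _ [[A B] /= [SA SB] <-].
by rewrite -f_isom; apply: ereal_sup_ubound; exists (f A, f B).
Qed.

Lemma diam_pow_preimage s S : (diam_pow s (f @^-1` S) <= diam_pow s S)%E.
Proof.
(* An empty preimage is set apart: its diameter is -oo, and powers are compared below through
   nonnegative factors. *)
rewrite {1}/diam_pow; case: ifPn => [_|/set0P[A SA]]; first exact: diam_pow_ge0.
rewrite /diam_pow ifF; last by apply/negbTE/set0P; exists (f A).
elim: s => // s ih; rewrite !expeS.
have f0 : (0 <= mx_diam (f @^-1` S))%E by apply: mx_diam_ge0; exists A.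
by apply: lee_pmul => //; [exact: expe_ge0 | exact: mx_diam_preimage].
Qed.

(** Pulling back a cover of [S] covers the preimage by sets of no larger diameter. Equality comes
    later, by applying this to the inverse isometry too. *)
Lemma hausdorff_preimage s S : (hausdorff s (f @^-1` S) <= hausdorff s S)%E.
Proof.
apply: ge_ereal_sup => _ [d d0 <-].
apply: (@le_trans _ _ (hausdorff_delta s d S)); last first.
  by apply: ereal_sup_ubound; exists d.
apply: le_ereal_inf_tmp => _ [F [Fd SF] <-].
apply: ge_ereal_inf.
exists (\sum_(0 <= k <oo) diam_pow s (f @^-1` F k))%E.
  exists (fun k => f @^-1` F k) => //; split.
    by move=> k; apply: le_trans (Fd k); exact: mx_diam_preimage.
  by move=> A /SF[k _ FA]; exists k.
by apply: lee_nneseries => k *; [exact: diam_pow_ge0 | exact: diam_pow_preimage].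
Qed.

End HausdorffIsometry.

Lemma hausdorff_isometry {R : realType} {m n : nat}
    (f g : 'M[R]_(m, n) -> 'M[R]_(m, n)) s S :
  cancel f g -> cancel g f ->
  (forall A B, mx_dist (f A) (f B) = mx_dist A B) ->
  hausdorff s (f @^-1` S) = hausdorff s S.
Proof.
move=> fK gK f_isom; apply/eqP; rewrite eq_le hausdorff_preimage //=.
have -> : S = g @^-1` (f @^-1` S) by apply/seteqP; split=> A /=; rewrite gK.
have -> : f @^-1` (g @^-1` (f @^-1` S)) = f @^-1` S.
  by apply/seteqP; split=> A /=; rewrite fK.
by apply: hausdorff_preimage => A B; rewrite -f_isom !gK.
Qed.

(** * Invariance under permutation matrices *)

Section PermutationInvariance.
Context {R : realType} {n : nat}.
Implicit Types (M : 'M[R]_n) (s : 'S_n).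

Lemma markov_uniform_isometry (f g : 'M[R]_n -> 'M[R]_n) :
  cancel f g -> cancel g f ->
  (forall A B, mx_dist (f A) (f B) = mx_dist A B) ->
  (forall M, markov_mx R n (f M) <-> markov_mx R n M) ->
  invariant_law (markov_uniform R n) f.
Proof.
move=> fK gK f_isom fM S _; rewrite /markov_uniform.
rewrite -[hausdorff _ (S `&` _)](hausdorff_isometry _ _ fK gK f_isom).
congr (hausdorff _ _ * _)%E; apply/seteqP.
by split=> M [SM MM]; split => //; apply/fM.
Qed.

Lemma markov_row_perm s M : markov_mx R n M -> markov_mx R n (row_perm s M).
Proof.
move=> [M0 M1]; split=> [i j|i]; first by rewrite mxE.
by rewrite -[RHS](M1 (s i)); apply: eq_bigr => j _; rewrite mxE.
Qed.

Lemma markov_col_perm s M : markov_mx R n M -> markov_mx R n (col_perm s M).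
Proof.
move=> [M0 M1]; split=> [i j|i]; first by rewrite mxE.
by rewrite -[RHS](M1 i) [RHS](reindex_perm s); apply: eq_bigr => j _; rewrite mxE.
Qed.

Lemma row_permVK s : cancel (@row_perm R n n s) (row_perm s^-1%g).
Proof. by move=> M; rewrite -row_permM mulVg row_perm1. Qed.

Lemma col_permVK s : cancel (@col_perm R n n s) (col_perm s^-1%g).
Proof. by move=> M; rewrite -col_permM mulVg col_perm1. Qed.

Lemma row_perm_invariant s :
  invariant_law (markov_uniform R n) (fun M => perm_mx s *m M).
Proof.
under eq_fun do rewrite -row_permE.
apply: (@markov_uniform_isometry _ (row_perm s^-1%g)).
- exact: row_permVK.
- by move=> M; rewrite -{1}(invgK s); exact: row_permVK.
- move=> A B; congr Num.sqrt; rewrite [RHS](reindex_perm s).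
  by apply: eq_bigr => i _; apply: eq_bigr => j _; rewrite !mxE.
- move=> M; split; last exact: markov_row_perm.
  by move=> /(markov_row_perm s^-1%g); rewrite row_permVK.
Qed.

Lemma col_perm_invariant s :
  invariant_law (markov_uniform R n) (fun M => M *m perm_mx s).
Proof.
have -> : (fun M => M *m perm_mx s) = (@col_perm R n n s^-1%g).
  by apply/funext => M; rewrite col_permE invgK.
apply: (@markov_uniform_isometry _ (col_perm s)).
- by move=> M; rewrite -{1}(invgK s); exact: col_permVK.
- exact: col_permVK.
- move=> A B; congr Num.sqrt.
  apply: eq_bigr => i _; rewrite [RHS](reindex_perm s^-1%g).
  by apply: eq_bigr => j _; rewrite !mxE.
- move=> M; split; last exact: markov_col_perm.
  by move=> /(markov_col_perm s); rewrite -{1}(invgK s) col_permVK.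
Qed.

End PermutationInvariance.

(** * Covers of a box by cubes *)

Section WeightedBoxCover.
Context {R : realType} {I : eqType}.
Variables (p : nat -> I -> R) (d : nat -> R) (r : R).
Hypotheses (d0 : forall k, 0 <= d k) (r0 : 0 <= r).

Let itv k i : set R := `[p k i - d k, p k i + d k].

(* Weights are needed for the induction: integrating out one coordinate
   multiplies the weight of the k-th cube by at most its side [2 * d k]. *)
Lemma weighted_cube_cover (l : seq I) (w : nat -> R) (c : R) :
  uniq l -> (forall k, 0 <= w k) -> 0 <= c ->
  (forall x : I -> R, (forall i, 0 <= x i <= r) ->
    (c%:E <= \sum_(0 <= k <oo) (w k * \prod_(i <- l) \1_(itv k i) (x i))%:E)%E) ->
  ((c * r ^+ size l)%:E <=
     \sum_(0 <= k <oo) (w k * (2 * d k) ^+ size l)%:E)%E.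
Proof.
elim: l w c => [|i l ih] w c /=.
  move=> _ w0 c0 /(_ (fun=> 0)); rewrite lexx r0 expr0 mulr1 => /(_ (fun=> isT)) h.
  apply: le_trans h _; apply: lee_nneseries => k _.
    by rewrite lee_fin mulr_ge0 // big_nil.
  by rewrite big_nil expr0 lexx.
move=> /andP[il ul] w0 c0 cov.
have dd0 k : 0 <= 2 * d k by rewrite mulr_ge0.
(* The pointwise bound for these new weights is obtained by integrating [cov] over coordinate [i] in
   [0, r]. *)
have := ih (fun k => w k * (2 * d k)) (c * r) ul.
rewrite exprS mulrA => /(_ (fun k => mulr_ge0 (w0 k) (dd0 k)) (mulr_ge0 c0 r0)) ih1.
suff /ih1 h : forall x : I -> R, (forall j, 0 <= x j <= r) ->
    ((c * r)%:E <= \sum_(0 <= k <oo)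
       (w k * (2 * d k) * \prod_(j <- l) \1_(itv k j) (x j))%:E)%E.
  apply: (le_trans h); apply: lee_nneseries => k _; first by rewrite lee_fin !mulr_ge0 // exprn_ge0.
  by rewrite exprS !mulrA lexx.
move=> x xr; pose mu := @lebesgue_measure R.
pose q k := w k * \prod_(j <- l) \1_(itv k j) (x j).
have q0 k : 0 <= q k by rewrite mulr_ge0 // prodr_ge0 // => j _; rewrite indicE.
have mD : measurable (`[0, r]%classic : set R) by exact: measurable_itv.
have muD : mu `[0, r]%classic = r%:E.
  rewrite /mu lebesgue_measure_itv /= lte_fin.
  case: ltP => [_|rle0]; first by rewrite oppr0 addr0.
  by congr (_%:E); apply/eqP; rewrite eq_le r0 rle0.
have mi k : measurable (itv k i) by exact: measurable_itv.
have mind k : measurable_fun `[0, r]%classic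
    (fun y : R => (q k * \1_(itv k i) y)%:E).
  by apply/measurable_EFinP; exact: measurable_funM.
have -> : (c * r)%:E = (\int[mu]_(y in `[0%R, r]) (c%:E))%E.
  by rewrite EFinM -muD; exact/esym/(integral_cst mu mD c%:E).
apply: (@le_trans _ _
   (\int[mu]_(y in `[0%R, r]) \sum_(0 <= k <oo) (q k * \1_(itv k i) y)%:E)%E).
  apply: ge0_le_integral => //.
  - apply: (@ge0_emeasurable_sum _ _ _ _
        (fun k y => (q k * \1_(itv k i) y)%:E) xpredT) => // k y _ _.
    by rewrite lee_fin mulr_ge0 // indicE.
  - move=> y; rewrite /= in_itv /= => yr.
    (* Only coordinate [i] changes, and [i] is not in [l], so the factors over [l] keep their
       values. *)
    pose x' j := if j == i then y else x j.
    have /cov h : forall j, 0 <= x' j <= r by move=> j; rewrite /x'; case: ifP.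
    apply: (le_trans h); apply: lee_nneseries => k _.
      rewrite lee_fin mulr_ge0 // prodr_ge0 // => j _; by rewrite indicE.
    rewrite lee_fin big_cons /x' eqxx /q -mulrA [X in _ * X]mulrC.
    rewrite le_eqVlt; apply/orP; left; apply/eqP; congr (_ * (_ * _)).
    apply: eq_big_seq => j jl; case: eqP => // ji.
    by rewrite ji (negbTE il) in jl.
rewrite integral_nneseries //; last first.
  by move=> k y _; rewrite lee_fin mulr_ge0 // indicE.
apply: lee_nneseries => k _.
  by move=> _; apply: integral_ge0 => y _; rewrite lee_fin mulr_ge0 // indicE.
under eq_integral do rewrite EFinM.
rewrite ge0_integralZl //; last 2 first.
  - apply/measurable_EFinP; exact: (@measurable_indic _ _ R _ _ (mi k)).
  - by rewrite lee_fin.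
have -> : w k * (2 * d k) * \prod_(j <- l) \1_(itv k j) (x j) = q k * (2 * d k).
  by rewrite mulrAC.
rewrite integral_indic; [|exact: mD|exact: mi].
rewrite [leRHS]EFinM; apply: lee_wpmul2l; first by rewrite lee_fin.
(* Dropping the restriction to [0, r] leaves the full side [2 * d k]. *)
apply: (@le_trans _ _ (mu (itv k i))).
  rewrite le_measure //.
    by apply: mem_set; exact: (measurableI _ _ (mi k) mD).
  by apply: mem_set; exact: mi.
rewrite /mu /itv lebesgue_measure_itv /= lte_fin; case: ifP => _; last first.
  by rewrite lee_fin.
by rewrite -EFinB lee_fin; lra.
Qed.

End WeightedBoxCover.

(** * Euclidean distance and entries *)

Section MatrixDistance.
Context {R : realType} {m n : nat}.
Implicit Types (A B : 'M[R]_(m, n)) (S : set 'M[R]_(m, n)).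

Lemma normr_entry_le_mx_dist A B i j : `|A i j - B i j| <= mx_dist A B.
Proof.
rewrite -sqrtr_sqr ler_wsqrtr // (bigD1 i) //= (bigD1 j) //= -addrA lerDl.
by rewrite addr_ge0 // sumr_ge0 // => k _; rewrite ?sqr_ge0 // sumr_ge0 // => l _;
  rewrite sqr_ge0.
Qed.

Lemma mx_dist_le A B e : (forall i j, `|A i j - B i j| <= e) -> 0 <= e ->
  mx_dist A B <= (m * n)%:R * e.
Proof.
move=> AB e0; rewrite -[leRHS]ger0_norm ?mulr_ge0 // -sqrtr_sqr ler_wsqrtr //.
apply: (@le_trans _ _ ((m * n)%:R * e ^+ 2)).
  apply: (@le_trans _ _ (\sum_(i < m) \sum_(j < n) e ^+ 2)).
    do 2 (apply: ler_sum => ? _).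
    by rewrite -real_normK ?num_real // lerXn2r ?nnegrE.
  by rewrite !sumr_const !card_ord -mulrnA mulnC mulr_natl.
(* The factor [m * n] is cruder than its square root; the natural number [m * n] is at most its own
   square. *)
rewrite exprMn ler_wpM2r ?sqr_ge0 // -natrX ler_nat.
by case: (m * n)%N => // k; rewrite expnS leq_pmulr.
Qed.

Lemma mx_diam_le S (e : R) : 
  (forall A B i j, S A -> S B -> `|A i j - B i j| <= e) -> 0 <= e ->
  (mx_diam S <= ((m * n)%:R * e)%:E)%E.
Proof.
move=> Se e0; apply: ge_ereal_sup => _ [[A B] /= [SA SB] <-].
by rewrite lee_fin mx_dist_le // => i j; exact: Se.
Qed.

End MatrixDistance.

(** * Upper and lower bounds for Hausdorff measure *)

Section HausdorffBounds.
Context {R : realType} {m n : nat}.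
Implicit Types (A B : 'M[R]_(m, n)) (S : set 'M[R]_(m, n)).

Lemma diam_pow_le s S (e : R) :
  (mx_diam S <= e%:E)%E -> 0 <= e -> (diam_pow s S <= (e ^+ s)%:E)%E.
Proof.
move=> Se e0; rewrite /diam_pow; case: ifPn => [_|/set0P S0].
  by rewrite lee_fin exprn_ge0.
elim: s => // s ih; rewrite expeS exprS EFinM.
by apply: lee_pmul => //; [exact: mx_diam_ge0|exact/expe_ge0/mx_diam_ge0].
Qed.

(** The list is continued by empty sets, which contribute 0 even when [s = 0]. *)
Lemma hausdorff_delta_finite_cover s d S (F : seq (set 'M[R]_(m, n))) (b : R) :
  (forall k, mx_diam (nth set0 F k) <= d%:E)%E ->
  (forall k, diam_pow s (nth set0 F k) <= b%:E)%E ->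
  S `<=` \bigcup_k nth set0 F k ->
  (hausdorff_delta s d S <= ((size F)%:R * b)%:E)%E.
Proof.
move=> Fd Fb SF; have b0 : 0 <= b.
  by rewrite -lee_fin; apply: le_trans (Fb 0%N); exact: diam_pow_ge0.
apply: ge_ereal_inf.
exists (\sum_(0 <= k <oo) diam_pow s (nth set0 F k))%E; first by exists (nth set0 F).
apply: lime_le; first by apply: is_cvg_nneseries => *; exact: diam_pow_ge0.
apply: nearW => p.
apply: (@le_trans _ _ ((minn p (size F))%:R * b)%:E); last first.
  by rewrite lee_fin ler_wpM2r // ler_nat geq_minr.
elim: p => [|p ih]; first by rewrite big_geq // min0n mul0r.
rewrite big_nat_recr //=; have [pF|Fp] := ltnP p (size F).
  rewrite (minn_idPl pF) mulrSr mulrDl mul1r EFinD leeD //.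
  by rewrite (minn_idPl (ltnW pF)) in ih.
rewrite nth_default // /diam_pow eqxx adde0 (minn_idPr _) ?(leqW Fp) //.
by rewrite (minn_idPr Fp) in ih.
Qed.

Lemma hausdorff_set0_le0 s : (hausdorff s (@set0 'M[R]_(m, n)) <= 0)%E.
Proof.
apply: ge_ereal_sup => _ [d d0 <-].
have := @hausdorff_delta_finite_cover s d set0 [::] 0; rewrite mul0r; apply=> // k.
  by rewrite nth_nil; apply: ge_ereal_sup => _ [[? ?] [[]]].
by rewrite nth_nil /diam_pow eqxx.
Qed.

Lemma hausdorff_ge0 s S : (0 <= hausdorff s S)%E.
Proof.
apply: le_ereal_sup_tmp; exists (hausdorff_delta s 1 S); first by exists 1 => //=.
apply: le_ereal_inf_tmp => _ [F _ <-].
by apply: nneseries_ge0 => k *; exact: diam_pow_ge0.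
Qed.

Context {I : finType} (pos : I -> 'I_m * 'I_n).

(** Coordinates do not increase distances: seen through the entries [pos i], a set of diameter [d]
    lies in a cube of side [2 * d] around any of its points. A cover of [S] thus yields a cover of
    the box by cubes. *)
Lemma hausdorff_box_ge S (phi : (I -> R) -> 'M[R]_(m, n)) (c : I -> R) (r : R) :
  0 <= r ->
  (forall x, (forall i, 0 <= x i <= r) -> S (phi x)) ->
  (forall x i, phi x (pos i).1 (pos i).2 = c i + x i) ->
  (((r / 2) ^+ #|I|)%:E <= hausdorff #|I| S)%E.
Proof.
(* One scale suffices for a lower bound; scale 1 makes all diameters of the cover finite. *)
move=> r0 Sphi phiE; apply: (@le_trans _ _ (hausdorff_delta #|I| 1 S)); last first.
  by apply: ereal_sup_ubound; exists 1 => //=.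
apply: le_ereal_inf_tmp => _ [F [F1 SF] <-].
pose d k : R := if F k == set0 then 0 else fine (mx_diam (F k)).
(* Weight 0 discards the empty sets, where [d] and [p] take default values, and agrees with
   [diam_pow] there, even in exponent 0. *)
pose w k : R := (F k != set0)%:R.
pose p k i : R := xget 0 (F k) (pos i).1 (pos i).2 - c i.
have dE k : F k != set0 -> mx_diam (F k) = (d k)%:E.
  move=> Fk; rewrite /d (negbTE Fk) fineK // fin_numElt.
  rewrite (lt_le_trans (ltNyr 0)) ?mx_diam_ge0 //; last exact/set0P.
  by rewrite (le_lt_trans (F1 k)) // ltry.
have d0 k : 0 <= d k.
  have [Fk|Fk] := eqVneq (F k) set0; first by rewrite /d Fk eqxx.
  by rewrite -lee_fin -dE // mx_diam_ge0 //; exact/set0P.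
have w0 k : 0 <= w k by [].
have := @weighted_cube_cover R I p d r d0 r0 (enum I) w 1 (enum_uniq _) w0 ler01.
rewrite mul1r -cardE => h.
have : ((r ^+ #|I|)%:E <= \sum_(0 <= k <oo) (w k * (2 * d k) ^+ #|I|)%:E)%E.
  apply: h => x xr; have [k _ Fk] := SF _ (Sphi x xr).
  have Fk0 : F k != set0 by apply/set0P; exists (phi x).
  (* The term of index [k] is 1 since [phi x] lies in [F k]; the partial sum up to [k] included is
     enough. *)
  apply: le_trans (nneseries_lim_ge k.+1 _) => [|l _ _]; last first.
    by rewrite lee_fin mulr_ge0 // prodr_ge0 // => i _; rewrite indicE.
  have -> : \sum_(0 <= l < k.+1) (w l * \prod_(i <- enum I)
      \1_`[p l i - d l, p l i + d l] (x i))%:E = (\sum_(0 <= l < k)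
      (w l * \prod_(i <- enum I) \1_`[p l i - d l, p l i + d l] (x i))%:E + 1)%E.
    rewrite big_nat_recr //= /w Fk0 mul1r; congr (_ + _%:E)%E.
    rewrite big1 // => i _; rewrite indicE mem_set //= in_itv /= -ler_distl.
    have -> : x i - p k i = phi x (pos i).1 (pos i).2 - xget 0 (F k) (pos i).1 (pos i).2.
      by rewrite phiE /p; ring.
    rewrite -lee_fin -dE //.
    apply: (@le_trans _ _ (mx_dist (phi x) (xget 0 (F k)))%:E).
      by rewrite lee_fin normr_entry_le_mx_dist.
    apply: ereal_sup_ubound; exists (phi x, xget 0 (F k)) => //; split => //=.
    by apply: (@xgetPex _ 0 (F k)); exists (phi x).
  rewrite leeDr // sume_ge0 // => l _; rewrite lee_fin; apply: mulr_ge0 => //.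
  by apply: prodr_ge0 => i _; rewrite indicE ler0n.
rewrite (_ : (\sum_(0 <= k <oo) _)%E =
    (\sum_(0 <= k <oo) (2 ^+ #|I|)%:E * diam_pow #|I| (F k))%E); last first.
  apply: eq_eseriesr => k _; rewrite /w /diam_pow; case: ifPn => Fk.
    by rewrite mul0r mule0.
  by rewrite mul1r exprMn EFinM dE // !EFin_expe.
rewrite nneseriesZl => [|k _]; last exact: diam_pow_ge0.
by rewrite -lee_pdivrMl ?exprn_gt0 // -EFinM expr_div_n mulrC.
Qed.

End HausdorffBounds.

(** * Finiteness and positivity on the Markov polytope *)

Section MarkovMass.
Context {R : realType} {m : nat}.
Local Notation n := m.+1.
Local Notation markov := (markov_mx R n).
Implicit Types (A B M : 'M[R]_n).

Lemma markov_le1 M i j : markov M -> M i j <= 1.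
Proof. by move=> [M0 M1]; rewrite -(M1 i) (bigD1 j) //= lerDl sumr_ge0. Qed.

Lemma markov_col0 M i : markov M -> M i ord0 = 1 - \sum_(j < m) M i (lift ord0 j).
Proof. by move=> [_ /(_ i)]; rewrite big_ord_recl => <-; rewrite addrK. Qed.

(** Grid of mesh [1 / N.+1] in the free columns. The indices run up to [N.+1], which is reached by
    an entry equal to 1. *)
Let cell (N : nat) (g : {ffun 'I_n * 'I_m -> 'I_N.+2}) : set 'M[R]_n :=
  [set M | markov M /\ forall i j,
    (g (i, j))%:R <= M i (lift ord0 j) * N.+1%:R <= (g (i, j)).+1%:R].

(** A free entry varies by at most the mesh, and an entry of the first column by at most [m] times
    the mesh. *)
Let cell_diam N g : (mx_diam (@cell N g) <= ((n * n)%:R * (n%:R / N.+1%:R))%:E)%E.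
Proof.
have N0 : 0 < N.+1%:R :> R by [].
apply: mx_diam_le => [A B i k [MA gA] [MB gB]|]; last by rewrite divr_ge0.
have AB j : `|A i (lift ord0 j) - B i (lift ord0 j)| <= N.+1%:R^-1.
  rewrite -(ler_pM2r N0) mulVf ?gt_eqF // -[X in _ * X]gtr0_norm // -normrM mulrBl.
  have /andP[] := gA i j; have /andP[] := gB i j.
  by rewrite ler_norml -!natr1 => *; lra.
have [j ->|->] := unliftP ord0 k.
  by apply: le_trans (AB j) _; rewrite ler_peMl ?invr_ge0 // ler1n.
rewrite !markov_col0 // opprB addrC addrA subrK -sumrB.
apply: le_trans (ler_norm_sum _ _ _) _.
apply: (@le_trans _ _ (\sum_(j < m) N.+1%:R^-1)).
  by apply: ler_sum => j _; rewrite distrC.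
by rewrite sumr_const card_ord -[leLHS]mulr_natl ler_wpM2r ?invr_ge0 // ler_nat.
Qed.

Lemma hausdorff_markov_lt_pinfty : (hausdorff (n * m) markov < +oo)%E.
Proof.
(* There are [N.+2 ^ (n * m)] cells, and [N.+2 <= 2 * N.+1] cancels the mesh, whence a bound
   independent of [N]. *)
apply: (@le_lt_trans _ _ ((2 * (n * n)%:R * n%:R) ^+ (n * m))%:E); last exact: ltry.
apply: ge_ereal_sup => _ [d d0 <-].
pose N := Num.truncn ((n * n)%:R * n%:R / d : R).
pose e : R := (n * n)%:R * (n%:R / N.+1%:R).
have N0 : 0 < N.+1%:R :> R by [].
have e0 : 0 <= e by rewrite mulr_ge0 // divr_ge0.
have ed : e <= d.
  rewrite /e mulrA ler_pdivrMr // [leRHS]mulrC -ler_pdivrMr //.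
  exact/ltW/truncnS_gt.
pose F := [seq @cell N g | g <- enum {ffun 'I_n * 'I_m -> 'I_N.+2}].
have Fe k : (mx_diam (nth set0 F k) <= e%:E)%E.
  have [kF|Fk] := ltnP k (size F); last first.
    by rewrite nth_default //; apply: ge_ereal_sup => _ [[? ?] [[]]].
  by have /mapP[g _ ->] := mem_nth set0 kF; exact: cell_diam.
have h := @hausdorff_delta_finite_cover R n n (n * m) d markov F (e ^+ (n * m)).
apply: le_trans (h _ _ _) _.
- by move=> k; apply: le_trans (Fe k) _; rewrite lee_fin.
- by move=> k; exact: diam_pow_le.
- move=> M MM.
  pose g : {ffun 'I_n * 'I_m -> 'I_N.+2} :=
    [ffun ij => inord (Num.truncn (M ij.1 (lift ord0 ij.2) * N.+1%:R))].
  exists (index g (enum {ffun 'I_n * 'I_m -> 'I_N.+2})) => //.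
  have gin : g \in enum {ffun 'I_n * 'I_m -> 'I_N.+2} by rewrite mem_enum.
  rewrite (nth_map g) ?index_mem // nth_index //; split => // i j.
  have Mge0 : 0 <= M i (lift ord0 j) * N.+1%:R by rewrite mulr_ge0 //; case: MM.
  have /andP[tl tu] := truncn_itv Mge0.
  rewrite ffunE inordK /= ?tl ?ltW //.
  rewrite ltnS -(ler_nat R); apply: le_trans tl _.
  by rewrite ler_piMl // markov_le1.
rewrite lee_fin size_map -cardE card_ffun card_prod !card_ord natrX -exprMn.
have -> : 2 * (n * n)%:R * n%:R = (2 * N.+1%:R) * e.
  by rewrite /e; field; rewrite gt_eqF.
rewrite lerXn2r ?nnegrE ?mulr_ge0 // ler_wpM2r // -natrM ler_nat.
by rewrite mul2n -addnn addSn addnS !ltnS leq_addl.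
Qed.

(** Moving [A] slightly towards the matrix with all entries [1 / n] makes every entry at least [u].
    There is then room for a small box in the free columns, compensated in the first one. *)
Lemma hausdorff_open_markov_gt0 (U : set 'M[R]_n) A :
  open U -> U A -> markov A -> (0 < hausdorff (n * m) (U `&` markov))%E.
Proof.
move=> oU UA MA.
have /nbhs_ballP[e /= e0 AU] : nbhs A U by exact: open_nbhs_nbhs.
(* Entries will move by at most [2 * t]; the factor 3 makes this strictly less than [e]. *)
have [t [t0 t1 te]] : exists t : R, [/\ 0 < t, t <= 1 & 3 * t <= e].
  exists (Num.min 1 (e / 3)); split; first by rewrite lt_min ltr01 divr_gt0.
    by rewrite ge_min lexx.
  by rewrite mulrC -ler_pdivlMr // ge_min lexx orbT.
have n0 : 0 < n%:R :> R by [].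
have [u [nu u0 ut]] : exists u : R, [/\ n%:R * u = t, 0 < u & u <= t].
  exists (t / n%:R); rewrite mulrC divfK ?gt_eqF // divr_gt0 //; split => //.
  by rewrite ler_pdivrMr // ler_peMr ?ler1n // ltW.
(* With [m * r <= u], the amount subtracted from the first column never exceeds [u]. *)
have [r [r0 mr ru]] : exists r : R, [/\ 0 < r, m%:R * r <= u & r <= u].
  exists (u / n%:R); rewrite divr_gt0 //; split => //.
    rewrite mulrCA; apply: ler_piMr; first exact: ltW.
    by rewrite ler_pdivrMr // mul1r ler_nat.
  by rewrite ler_pdivrMr // ler_peMr ?ler1n // ltW.
pose h (x : 'I_n * 'I_m -> R) i (k : 'I_n) : R :=
  if unlift ord0 k is Some j then x (i, j) else - \sum_(j < m) x (i, j).
pose phi x : 'M[R]_n := \matrix_(i, k) ((1 - t) * A i k + u + h x i k).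
pose pos (ij : 'I_n * 'I_m) : 'I_n * 'I_n := (ij.1, lift ord0 ij.2).
pose c ij := (1 - t) * A (pos ij).1 (pos ij).2 + u.
have : (((r / 2) ^+ #|{: 'I_n * 'I_m}|)%:E <=
        hausdorff #|{: 'I_n * 'I_m}| (U `&` markov))%E.
  apply: (@hausdorff_box_ge R n n _ pos _ phi c r (ltW r0)); last first.
    by move=> x [i j]; rewrite mxE /= /h liftK.
  move=> x xr.
  have sx i : 0 <= \sum_(j < m) x (i, j) <= u.
    rewrite sumr_ge0 => [|j _]; last by case/andP: (xr (i, j)).
    apply: le_trans mr; rewrite -[m in leRHS]card_ord mulr_natl -sumr_const.
    by apply: ler_sum => j _; case/andP: (xr (i, j)).
  have hu i k : - u <= h x i k <= u.
    have /andP[s0 s1] := sx i; apply/andP; rewrite /h; case: unliftP => [j _|_].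
      by have /andP[x0 x1] := xr (i, j); split; lra.
    by split; lra.
  split.
    apply: AU; split => // i k; rewrite /ball /= mxE ltr_distl mulrBl mul1r.
    have A0 := MA.1 i k; have A1 := markov_le1 i k MA; have /andP[] := hu i k.
    have tA0 : 0 <= t * A i k by rewrite mulr_ge0 // ltW.
    have tA1 : t * A i k <= t by rewrite ler_piMr // ltW.
    by move: (h x i k) => y y0 y1; apply/andP; split; lra.
  split=> [i k|i].
    rewrite mxE; have /andP[+ _] := hu i k.
    have A0 : 0 <= (1 - t) * A i k by rewrite mulr_ge0 ?subr_ge0 //; case: MA.
    by move: (h x i k) => y y0; rewrite -addrA addr_ge0 //; lra.
  under eq_bigr do rewrite mxE.
  rewrite !big_split /= -mulr_sumr MA.2 sumr_const card_ord big_ord_recl /h unlift_none.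
  under [X in _ + (_ + X)]eq_bigr do rewrite liftK.
  by rewrite addNr addr0 -mulr_natl nu mulr1 subrK.
rewrite card_prod !card_ord; apply: lt_le_trans.
by rewrite lte_fin exprn_gt0 // divr_gt0.
Qed.

Lemma markov_uniform_open_gt0 (U : set 'M[R]_n) A :
  open U -> U A -> markov A -> (0 < markov_uniform R n U)%E.
Proof.
move=> oU UA MA; rewrite /markov_uniform /= mule_gt0 //.
  exact: hausdorff_open_markov_gt0 UA MA.
(* The total mass must be positive and finite: [fine] sends +oo to 0, and the inverse of 0 is 0. *)
have := hausdorff_open_markov_gt0 openT (I : setT A) MA; rewrite setTI => M0.
by rewrite lte_fin invr_gt0 fine_gt0 // M0 hausdorff_markov_lt_pinfty.
Qed.

End MarkovMass.

(** * Failure of invariance for other Markov matrices *)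

Section NonInvariance.
Context {R : realType}.

Lemma markov_mx1 n : markov_mx R n 1%:M.
Proof.
split=> [i j|i]; first by rewrite mxE ler0n.
rewrite (bigD1 i) //= mxE eqxx big1 ?addr0 // => j ji.
by rewrite mxE eq_sym (negbTE ji).
Qed.

Lemma open_entry_mulmx_lt0 n (A : 'M[R]_n) i j : open [set B : 'M[R]_n | (A *m B) i j < 0].
Proof.
apply: (@open_comp _ _ (fun B : 'M[R]_n => (A *m B) i j) [set y | y < 0]).
  move=> B _; under eq_fun do rewrite mxE.
  apply: (@continuous_big R 'I_n +%R 0 xpredT _ 'M[R]_n _
    (fun k B => A i k * B k j)) => [|k _].
    by move=> ?; exact: add_continuous.
  by move=> C; apply: continuousM; [exact: cst_continuous|exact: coord_continuous].
exact: open_lt.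
Qed.

(** [U] has positive mass as a neighbourhood of the identity, while its preimage misses the polytope
    and has mass 0. *)
Lemma markov_uniform_not_invariant n (f : 'M[R]_n.+1 -> 'M[R]_n.+1)
    (U : set 'M[R]_n.+1) :
  open U -> U 1%:M -> (forall M, markov_mx R n.+1 M -> ~ U (f M)) ->
  ~ invariant_law (markov_uniform R n.+1) f.
Proof.
move=> oU U1 Uf /(_ U); have bU : borel_mx U by exact: sub_sigma_algebra.
move=> /(_ bU) fU.
have := markov_uniform_open_gt0 oU U1 (@markov_mx1 n.+1).
rewrite -fU ltNge /markov_uniform (_ : _ `&` _ = set0); last first.
  by apply/seteqP; split=> // M [UM MM]; exact: Uf MM UM.
by rewrite mule_le0_ge0 ?hausdorff_set0_le0 // lee_fin invr_ge0 fine_ge0 // hausdorff_ge0.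
Qed.

Lemma open_entry_mulmxr_lt0 n (A : 'M[R]_n) i j :
  open [set B : 'M[R]_n | (B *m A) i j < 0].
Proof.
apply: (@open_comp _ _ (fun B : 'M[R]_n => (B *m A) i j) [set y | y < 0]).
  move=> B _; under eq_fun do rewrite mxE.
  apply: (@continuous_big R 'I_n +%R 0 xpredT _ 'M[R]_n _
    (fun k B => B i k * A k j)) => [|k _].
    by move=> ?; exact: add_continuous.
  by move=> C; apply: continuousM; [exact: coord_continuous|exact: cst_continuous].
exact: open_lt.
Qed.

Lemma left_invariant_perm n (T : 'M[R]_n.+1) : markov_mx R n.+1 T ->
  invariant_law (markov_uniform R n.+1) (fun M => T *m M) -> is_perm_mx T.
Proof.
move=> MT inv; have [//|nT] := boolP (is_perm_mx T); exfalso.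
have [A [i [j [Aij AT]]]] := left_separation MT nT.
have oU : open [set B : 'M[R]_n.+1 | (A *m B) i j < 0] by exact: open_entry_mulmx_lt0.
apply: (markov_uniform_not_invariant oU _ _ inv) => /=.
  by rewrite mulmx1.
(* Row [i] of [A *m T] and all entries of [M] are nonnegative. *)
move=> M [M0 _]; rewrite mulmxA mxE; apply/negP; rewrite -leNgt.
by apply: sumr_ge0 => k _; rewrite mulr_ge0.
Qed.

Lemma right_invariant_perm n (T : 'M[R]_n.+1) : markov_mx R n.+1 T ->
  invariant_law (markov_uniform R n.+1) (fun M => M *m T) -> is_perm_mx T.
Proof.
move=> MT inv; have [//|nT] := boolP (is_perm_mx T); exfalso.
have [A [i [j [Aij TA]]]] := right_separation MT nT.
have oU : open [set B : 'M[R]_n.+1 | (B *m A) i j < 0] by exact: open_entry_mulmxr_lt0.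
apply: (markov_uniform_not_invariant oU _ _ inv) => /=.
  by rewrite mul1mx.
move=> M [M0 _]; rewrite -mulmxA mxE; apply/negP; rewrite -leNgt.
by apply: sumr_ge0 => k _; rewrite mulr_ge0.
Qed.

End NonInvariance.

Theorem theorem1p3 (R : realType) (n : nat) (T : 'M[R]_n)
    (hn : (1 <= n)%N) (hT : markov_mx R n T) :
  (invariant_law (markov_uniform R n) (fun M => T *m M) <-> is_perm_mx T) /\
  (invariant_law (markov_uniform R n) (fun M => M *m T) <-> is_perm_mx T).
Proof.
case: n hn => // n _ in T hT *.
split; split; [exact: left_invariant_perm| |exact: right_invariant_perm|].
- by move=> /is_perm_mxP[s ->]; exact: row_perm_invariant.
- by move=> /is_perm_mxP[s ->]; exact: col_perm_invariant.
Qed.
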